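(* Let $*\in\{1,\dots,n\}$. The optimization problem $P_*$ (defined in the context) is equivalent to the optimization problem obtained from $P_*$ by replacing the grid constraints by $C\cup\{0\le p_i\le 1 : 1\le i\le n\}$, where $$C=\{c_{M,L} : L\in 2^{S},\ M=\mathrm{OnlyAuditedBy}(L),\ |L|<|M|\}.$$ That is, both problems have the same objective in terms of $(p_1,\dots,p_n,x)$ and admit exactly the same set of feasible vectors $(p_1,\dots,p_n,x)$.
   Context: Audit game. There are $n$ targets $T=\{t_1,\dots,t_n\}$ and $k<n$ inspection resources $S=\{s_1,\dots,s_k\}$. A set $R$ of pairs is given, where $(j,i)\in R$ means resource $s_j$ cannot audit target $t_i$. The defender's utilities are $U^a_D(t_i)\ge U^u_D(t_i)$ (target attacked while audited / unaudited), the adversary's are $U^a_A(t_i)\le U^u_A(t_i)$, and $a$ is a constant. Problem $P_*$ (variables $p_i^j$ for $1\le i\le n$, $1\le j\le k$, and $x$): maximize $p_*U^a_D(t_* )+(1-p_* )U^u_D(t_* )-ax$ subject to (1) $p_i(U^a_A(t_i)-x)+(1-p_i)U^u_A(t_i)\le p_*(U^a_A(t_* )-x)+(1-p_* )U^u_A(t_* )$ for all $i\ne *$; (2) the grid constraints: $0\le p_i=\sum_{j=1}^k p_i^j\le 1$ for all $i$; $0\le\sum_{i=1}^n p_i^j\le 1$ for all $j$; $p_i^j\ge 0$ for all $(j,i)$; $p_i^j=0$ for all $(j,i)\in R$; (3) $0\le x\le 1$. In the replaced problem the variables are $p_1,\dots,p_n,x$. For $L\subseteq S$, $\mathrm{OnlyAuditedBy}(L)$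 is the set of targets $t_i$ such that no resource outside $L$ can audit $t_i$, i.e. $(j,i)\in R$ for every $s_j\notin L$. For $M=\mathrm{OnlyAuditedBy}(L)$, $c_{M,L}$ denotes the constraint $\sum_{i:\,t_i\in M}p_i\le|L|$. *)

(* Defs.v *)
From HB Require Import structures.
From mathcomp Require Import all_boot all_order all_algebra.

Set Implicit Arguments.
Unset Strict Implicit.
Unset Printing Implicit Defensive.

Import Order.TTheory GRing.Theory Num.Theory.
Local Open Scope ring_scope.

Record max_problem (R : realFieldType) := MaxProblem {
  variables : Type;
  feasible : variables -> Prop;
  objective : variables -> R }.

(* [P], read through the change of variables [f], has the objective of [Q] and
   exactly the feasible vectors of [Q]. The objectives agree on all of the
   variables of [P], not only at feasible ones. *)
Definition equivalent_via (R : realFieldType) (P Q : max_problem R)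
    (f : variables P -> variables Q) : Prop :=
  (forall v, objective v = objective (f v)) /\
  (forall w, feasible w <-> exists2 v, feasible v & f v = w).

(* Targets are indexed by 'I_n and inspection resources by 'I_k. The utilities
   carry the player as a capital letter (D defender, A adversary) and the
   status of the attacked target as a lower-case one (a audited, u unaudited).
   [audit_cost] is the constant a, of arbitrary sign. *)
Record audit_game (R : realFieldType) (n k : nat) := AuditGame {
  cannot_audit : {set 'I_k * 'I_n};
  UDa : 'I_n -> R;
  UDu : 'I_n -> R;
  UAa : 'I_n -> R;
  UAu : 'I_n -> R;
  audit_cost : R;
  UDu_le_UDa : forall i, UDu i <= UDa i;
  UAa_le_UAu : forall i, UAa i <= UAu i }.

Section Problems.
Variables (R : realFieldType) (n k : nat) (G : audit_game R n k).
Variable star : 'I_n.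

Implicit Types (p : {ffun 'I_n -> R}) (q : 'M[R]_(n, k)) (x : R).

Definition defender_objective p x : R :=
  p star * UDa G star + (1 - p star) * UDu G star - audit_cost G * x.

Definition adversary_utility p x (i : 'I_n) : R :=
  p i * (UAa G i - x) + (1 - p i) * UAu G i.

Definition best_response p x : Prop :=
  forall i, i != star -> adversary_utility p x i <= adversary_utility p x star.

(* The entry [q i j] is p_i^j: rows are targets, columns are resources. *)
Definition audit_prob q : {ffun 'I_n -> R} := [ffun i => \sum_(j < k) q i j].

Definition grid_constraints q : Prop :=
  [/\ forall i, 0 <= audit_prob q i <= 1,
      forall j, 0 <= \sum_(i < n) q i j <= 1,
      forall i j, 0 <= q i j
    & forall i j, (j, i) \in cannot_audit G -> q i j = 0].

Definition P_star : max_problem R :=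
  @MaxProblem R ('M[R]_(n, k) * R)%type
    (fun v => [/\ best_response (audit_prob v.1) v.2,
                  grid_constraints v.1
                & 0 <= v.2 <= 1])
    (fun v => defender_objective (audit_prob v.1) v.2).

Definition OnlyAuditedBy (L : {set 'I_k}) : {set 'I_n} :=
  [set i | [forall j, (j \notin L) ==> ((j, i) \in cannot_audit G)]].

Definition c_constraint (M : {set 'I_n}) (L : {set 'I_k}) p : Prop :=
  \sum_(i in M) p i <= #|L|%:R.

(* The family C, each constraint c_{M,L} being represented by the pair (M, L). *)
Definition C_index : {set {set 'I_n} * {set 'I_k}} :=
  [set ML | (ML.1 == OnlyAuditedBy ML.2) && (#|ML.2| < #|ML.1|)%N].

Definition P_star_replaced : max_problem R :=
  @MaxProblem R ({ffun 'I_n -> R} * R)%type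
    (fun w => [/\ best_response w.1 w.2,
                  forall M L, (M, L) \in C_index -> c_constraint M L w.1,
                  forall i, 0 <= w.1 i <= 1
                & 0 <= w.2 <= 1])
    (fun w => defender_objective w.1 w.2).

Definition project_vars (v : variables P_star) : variables P_star_replaced :=
  (audit_prob v.1, v.2).

End Problems.

(* Main.v *)
(** The content is a fractional Hall theorem: demands [p] can be routed along
    the edges [E] within capacities [c] as soon as every pair [(A, B)] such that
    all edges from [A] end in [B] satisfies [p(A) <= c(B)]. By induction on the
    number of edges: route an amount [t] along an edge [(i, j)] and delete it.
    The pairs with [i \in A], [j \notin B] bound [t] from below, those with
    [i \notin A], [j \in B] from above, and modularity of [p] and [c] under
    unions and intersections makes these bounds compatible. *)
Require Import Defs.
From mathcomp Require Import all_boot all_order all_algebra.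
From mathcomp Require Import lra.

Set Implicit Arguments.
Unset Strict Implicit.
Unset Printing Implicit Defensive.

Import Order.TTheory GRing.Theory Num.Theory.
Local Open Scope ring_scope.

(** Any [B] containing the neighbours of [A] is allowed, not just the neighbourhood itself, so these
    pairs are closed under componentwise union and intersection. *)
Definition traps (I J : finType) (E : {set I * J}) (A : {set I}) (B : {set J}) :=
  [forall e in E, (e.1 \in A) ==> (e.2 \in B)].

Lemma trapsP (I J : finType) (E : {set I * J}) (A : {set I}) (B : {set J}) :
  reflect (forall i j, (i, j) \in E -> i \in A -> j \in B) (traps E A B).
Proof.
apply: (iffP forall_inP) => [h i j Eij Ai | h [i j] Eij].
  exact: implyP (h _ Eij) Ai.
by apply/implyP; apply: h.
Qed.

Lemma sum_setUI (V : nmodType) (T : finType) (f : T -> V) (A B : {set T}) :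
  \sum_(i in A :|: B) f i + \sum_(i in A :&: B) f i =
  \sum_(i in A) f i + \sum_(i in B) f i.
Proof.
rewrite (big_setID B) [\sum_(i in A) _](big_setID B) /=.
rewrite setIUl setIid setDUl setDv setU0 (setUidPr (subsetIr A B)).
by rewrite -addrA addrC [X in X + _]addrC.
Qed.

Lemma sum_sub_pulse (V : zmodType) (T : finType) (f : T -> V) (a : T) (t : V)
    (A : {set T}) :
  \sum_(i in A) (f i - (if i == a then t else 0)) =
  \sum_(i in A) f i - (if a \in A then t else 0).
Proof.
rewrite sumrB -big_mkcondr; congr (_ - _).
case: ifPn => [Aa | nAa].
  rewrite (big_pred1 a) // => i /=.
  by case: eqVneq => [-> | _]; rewrite ?Aa ?andbF.
by rewrite big1 // => i /andP[Ai /eqP ia]; rewrite -ia Ai in nAa.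
Qed.

Lemma fractional_hall (R : realFieldType) (I J : finType) (E : {set I * J})
    (p : I -> R) (c : J -> R) :
  (forall i, 0 <= p i) ->
  (forall A B, traps E A B -> \sum_(i in A) p i <= \sum_(j in B) c j) ->
  exists q : I -> J -> R,
    [/\ forall i j, 0 <= q i j,
        forall i j, (i, j) \notin E -> q i j = 0,
        forall i, \sum_j q i j = p i
      & forall j, \sum_i q i j <= c j].
Proof.
have [m] := ubnP #|E|; elim: m => // m IHm in E p c *.
rewrite ltnS => leEm p_ge0 hall.
have c_ge0 j : 0 <= c j.
  have := hall set0 [set j]; rewrite big_set0 big_set1; apply.
  by apply/trapsP => i j' _; rewrite !inE.
have [E0 | [[i j] Eij]] := set_0Vmem E.
  exists (fun _ _ => 0); split=> // [i | j]; last by rewrite big1.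
  rewrite big1 //; apply/le_anti; rewrite p_ge0 andTb.
  have := hall [set i] set0; rewrite big_set0 big_set1; apply.
  (* Without edges even the pair of [[set i]] and [set0] is trapping, which forces [p i <= 0]. *)
  by apply/trapsP => i' j'; rewrite E0 !inE.
set E' := E :\ (i, j).
have trapsE A B : traps E' A B -> (i \in A -> j \in B) -> traps E A B.
  move=> /trapsP tr ij; apply/trapsP => i' j' Eij'.
  have [[-> ->] // | ne] := eqVneq (i', j') (i, j).
  by apply: tr; rewrite !inE ne.
(* These are exactly the pairs that become trapping once [(i, j)] is deleted, so [hall] says nothing
   about them yet. *)
pose below (AB : {set I} * {set J}) :=
  [&& traps E' AB.1 AB.2, i \in AB.1 & j \notin AB.2].
(* The least nonnegative amount that covers the deficit of every such pair. Because of the default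
   0, each upper bound on [t] must also be checked against 0. *)
pose t := \big[Num.max/0]_(AB | below AB)
            (\sum_(i in AB.1) p i - \sum_(j in AB.2) c j).
have t_ge0 : 0 <= t by exact: bigmax_ge_id.
have t_ge A B : traps E' A B -> i \in A -> j \notin B ->
    \sum_(i in A) p i - \sum_(j in B) c j <= t.
  move=> tr Ai nBj.
  by apply: (le_bigmax_cond _ (j := (A, B))); apply/and3P.
have t_le_p : t <= p i.
  apply: bigmax_le => // -[A B] /and3P[/= tr Ai nBj].
  (* Removing [i] from [A] gives a pair that traps [E] itself. *)
  rewrite (big_setD1 i) //= lerBlDr lerD2l.
  apply: hall; apply: trapsE; last by rewrite !inE eqxx.
  apply/trapsP => i' j' Eij' /setD1P[_ Ai']; exact: (trapsP _ _ _ tr) Ai'.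
have t_le_c : t <= c j.
  apply: bigmax_le => // -[A B] /and3P[/= tr Ai nBj].
  (* Dually, adding [j] to [B] repairs the pair. *)
  rewrite lerBlDr -big_setU1 //=.
  apply: hall; apply: trapsE; last by rewrite !inE eqxx.
  apply/trapsP => i' j' Eij' Ai'.
  by rewrite inE (trapsP _ _ _ tr _ _ Eij' Ai') orbT.
have t_le A B : traps E' A B -> i \notin A -> j \in B ->
    t <= \sum_(j in B) c j - \sum_(i in A) p i.
  move=> tr nAi Bj; apply: bigmax_le => [|[A' B'] /and3P[/= tr' Ai' nBj']].
    by rewrite subr_ge0; apply: hall; apply: trapsE.
  (* The pair [(A', B')] does not trap [E], but the union and the intersection with [(A, B)] do: [j]
     lies in the union of the right sides, [i] outside the intersection of the left ones. *)
  have hallU : \sum_(i in A :|: A') p i <= \sum_(j in B :|: B') c j.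
    apply: hall; apply: trapsE; last by rewrite !inE Bj.
    apply/trapsP => i1 j1 E1; rewrite !inE => /orP[] A1.
      by rewrite (trapsP _ _ _ tr _ _ E1 A1).
    by rewrite (trapsP _ _ _ tr' _ _ E1 A1) orbT.
  have hallI : \sum_(i in A :&: A') p i <= \sum_(j in B :&: B') c j.
    apply: hall; apply: trapsE; last by rewrite !inE (negPf nAi).
    apply/trapsP => i1 j1 E1; rewrite !inE => /andP[A1 A1'].
    by rewrite (trapsP _ _ _ tr _ _ E1 A1) (trapsP _ _ _ tr' _ _ E1 A1').
  by have := sum_setUI p A A'; have := sum_setUI c B B'; lra.
have [|||q [q_ge0 qE' q_row q_col]] := IHm E'
    (fun i' => p i' - (if i' == i then t else 0))
    (fun j' => c j' - (if j' == j then t else 0)).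
- by rewrite (cardsD1 (i, j)) Eij in leEm.
- move=> i'; case: eqP => [-> | _]; first by rewrite subr_ge0.
  by rewrite subr0.
- move=> A B tr; rewrite !sum_sub_pulse.
  have [Ai | nAi] := boolP (i \in A); have [Bj | nBj] := boolP (j \in B).
  + by rewrite lerD2r; apply: hall; apply: trapsE.
  + by have := t_ge _ _ tr Ai nBj; lra.
  + by have := t_le _ _ tr nAi Bj; lra.
  + rewrite lerD2r; apply: hall; apply: trapsE => //.
    by rewrite (negPf nAi).
exists (fun i' j' => q i' j' + (if (i' == i) && (j' == j) then t else 0)).
split=> [i' j' | i' j' nE | i' | j'].
- by rewrite addr_ge0 //; case: ifP.
- rewrite qE'; last by rewrite !inE (negPf nE) andbF.
  case: ifP => [/andP[/eqP ii /eqP jj] | _]; last by rewrite addr0.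
  by rewrite ii jj Eij in nE.
- rewrite big_split /= q_row -big_mkcond /=.
  case: eqP => _ /=; first by rewrite big_pred1_eq subrK.
  by rewrite big_pred0_eq subr0 addr0.
- rewrite big_split /= -lerBrDr; apply: le_trans (q_col j') _.
  rewrite -big_mkcond /= lerD2l lerN2.
  case: eqP => _; last by rewrite big_pred0 // => i'; rewrite andbF.
  by rewrite (big_pred1 i) // => i'; rewrite /= andbT.
Qed.

(** Double counting: rows of targets in [OnlyAuditedBy G L] are supported on [L], and each column in
    [L] carries total mass at most 1. *)
Lemma grid_c_constraint (R : realFieldType) (n k : nat) (G : audit_game R n k)
    (q : 'M[R]_(n, k)) (L : {set 'I_k}) :
  grid_constraints G q -> c_constraint (OnlyAuditedBy G L) L (audit_prob q).
Proof.
case=> _ q_col q_ge0 qR; rewrite /c_constraint.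
have -> : \sum_(i in OnlyAuditedBy G L) audit_prob q i =
          \sum_(i in OnlyAuditedBy G L) \sum_(j in L) q i j.
  apply: eq_bigr => i; rewrite inE => /forallP onlyL.
  rewrite ffunE [RHS]big_mkcond; apply: eq_bigr => j _.
  by case: ifPn => // nLj; apply: qR; apply: implyP (onlyL j) nLj.
rewrite exchange_big -sum1_card natr_sum; apply: ler_sum => j _.
have /andP[_] := q_col j; apply: le_trans.
by rewrite [leLHS]big_mkcond; apply: ler_sum => i _; case: ifP.
Qed.

Lemma grid_constraints_exist (R : realFieldType) (n k : nat)
    (G : audit_game R n k) (p : {ffun 'I_n -> R}) :
  (forall i, 0 <= p i <= 1) ->
  (forall M L, (M, L) \in C_index G -> c_constraint M L p) ->
  exists2 q, grid_constraints G q & audit_prob q = p.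
Proof.
move=> p01 cC.
have p_ge0 i : 0 <= p i by case/andP: (p01 i).
pose E := [set e : 'I_n * 'I_k | (e.2, e.1) \notin cannot_audit G].
have [A B /trapsP tr|q [q_ge0 qE q_row q_col]] :=
    @fractional_hall R _ _ E p (fun _ => 1) p_ge0.
  rewrite sumr_const.
  (* For fixed [B], the largest set trapped into [B] is [OnlyAuditedBy G B]; as [p] is nonnegative,
     it gives the strongest condition. *)
  have sAM : A \subset OnlyAuditedBy G B.
    apply/subsetP => i Ai; rewrite inE; apply/forallP => j.
    apply/implyP; apply: contraNT => Rji.
    by apply: tr Ai; rewrite inE.
  apply: (@le_trans _ _ (\sum_(i in OnlyAuditedBy G B) p i)).
    rewrite [leRHS](big_setID A) /= (setIidPr sAM) lerDl.
    by apply: sumr_ge0.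
  have [lt | le] := ltnP #|B| #|OnlyAuditedBy G B|.
    by apply: cC; rewrite inE /= eqxx.
  (* Pairs left out of [C_index] have at least as many resources as targets, so [p i <= 1]
     suffices. *)
  apply: (@le_trans _ _ #|OnlyAuditedBy G B|%:R); last by rewrite ler_nat.
  rewrite -sum1_card natr_sum; apply: ler_sum => i _.
  by case/andP: (p01 i).
have probE : audit_prob (\matrix_(i, j) q i j) = p.
  by apply/ffunP => i; rewrite ffunE -q_row; apply: eq_bigr => j _; rewrite mxE.
exists (\matrix_(i, j) q i j) => //; split; rewrite ?probE //.
- move=> j; under eq_bigr do rewrite mxE.
  by rewrite q_col andbT sumr_ge0.
- by move=> i j; rewrite mxE.
- by move=> i j Rji; rewrite mxE qE // inE negbK.
Qed.

Theorem lemma1 (R : realFieldType) (n k : nat) (k_lt_n : (k < n)%N)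
    (G : audit_game R n k) (star : 'I_n) :
  equivalent_via (P := P_star G star) (Q := P_star_replaced G star)
    (@project_vars R n k G star).
Proof.
split=> [// | [p x]]; split=> [[br cC p01 x01] | [[q y] [br grid y01] [<- <-]]].
  have [q grid qp] := grid_constraints_exist p01 cC.
  by exists (q, x); rewrite /project_vars /= ?qp.
split=> //= [M L | ]; last by case: grid.
by rewrite inE => /andP[/eqP /= -> _]; apply: grid_c_constraint.
Qed.
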